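(* Let $\mathcal{C}$ be a packing of the plane $\mathbb{R}^2$ with circular discs, each of radius at most $1$. Then the $(1+10^{-5})$-enlargement of $\mathcal{C}$ covers no square with side length $4$; that is, for every square $S\subset\mathbb{R}^2$ (solid, in any position) with side length $4$, $S\not\subseteq\bigcup_{C\in\mathcal{C}} C^{\varepsilon}$, where $\varepsilon=10^{-5}$ and $C^{\varepsilon}$ denotes the disc $C$ enlarged by the factor $1+\varepsilon$ from its center.
   Context: A packing is a system $\mathcal{C}$ (finite or infinite) of centrally symmetric convex bodies (compact convex sets with nonempty interior) whose interiors are pairwise disjoint; here the bodies are closed circular discs of positive radius in $\mathbb{R}^2$. For a centrally symmetric convex body $C$ with center of symmetry $c$ and $\varepsilon>0$, put $C^{\varepsilon}=(1+\varepsilon)(C-c)+c$. The $(1+\varepsilon)$-enlargement of $\mathcal{C}$ is the system $\{C^{\varepsilon} : C\in\mathcal{C}\}$, and it covers a set $X$ if $X$ is contained in the union of its members. *)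

(* Defs.v *)
From mathcomp Require Import all_boot all_order all_algebra.
From mathcomp Require Import all_classical all_reals all_analysis.
Import Order.TTheory GRing.Theory Num.Theory.
Import numFieldNormedType.Exports.

Set Implicit Arguments.
Unset Strict Implicit.
Unset Printing Implicit Defensive.

Local Open Scope classical_set_scope.
Local Open Scope ring_scope.

(* The norm that the library puts on ['rV[R]_n] is the sup norm, so the
   Euclidean structure is defined here. Both norms induce the same topology:
   [compact] and [interior] below are the usual notions. *)
Definition dotv (R : realType) (n : nat) (u v : 'rV[R]_n) : R :=
  \sum_(i < n) u 0 i * v 0 i.

Definition enorm (R : realType) (n : nat) (u : 'rV[R]_n) : R :=
  Num.sqrt (dotv u u).

Definition symmetry_center (R : realType) (n : nat) (B : set 'rV[R]_n)
    (c : 'rV[R]_n) : Prop :=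
  forall x, B x -> B (c + (c - x)).

Definition symmetric_convex_body (R : realType) (n : nat)
    (B : set 'rV[R]_n) : Prop :=
  [/\ compact B, convex_set B, interior B !=set0
    & exists c, symmetry_center B c].

(* A system of bodies is a set of sets: bodies with disjoint nonempty interiors
   cannot be repeated, so an indexed family would carry no more information. *)
Definition packing (R : realType) (n : nat) (C : set (set 'rV[R]_n)) : Prop :=
  (forall B, C B -> symmetric_convex_body B) /\ trivIset C (@interior 'rV[R]_n).

Definition enlarge (R : realType) (n : nat) (eps : R) (c : 'rV[R]_n)
    (B : set 'rV[R]_n) : set 'rV[R]_n :=
  [set (1 + eps) *: (x - c) + c | x in B].

(* The center of a body is unique, so each member of [C] contributes
   exactly one set. *)
Definition enlargement (R : realType) (n : nat) (eps : R)
    (C : set (set 'rV[R]_n)) : set (set 'rV[R]_n) :=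
  [set E | exists B c, [/\ C B, symmetry_center B c & E = enlarge eps c B]].

Definition covers (R : realType) (n : nat) (F : set (set 'rV[R]_n))
    (X : set 'rV[R]_n) : Prop :=
  X `<=` \bigcup_(E in F) E.

Definition disc (R : realType) (c : 'rV[R]_2) (r : R) : set 'rV[R]_2 :=
  closed_ball_ (@enorm R 2) c r.

Definition is_square (R : realType) (a : R) (S : set 'rV[R]_2) : Prop :=
  exists p u v : 'rV[R]_2,
    [/\ enorm u = a, enorm v = a, dotv u v = 0
      & S = [set x | exists s t : R,
               [/\ 0 <= s <= 1, 0 <= t <= 1 & x = p + s *: u + t *: v]]].

(* Main.v *)
(* The plane contains points x whose distance to every disc of the packing is at
   least k times the radius of that disc, for some k > 10^-5. Such a point is the
   limit of points x_n that are, at scales rho_n decreasing by factors of 80, at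
   distance at least rho_n from every disc of radius at least 6.5 rho_n.

   Suppose that at the next scale d = rho / 80 the point x is too close to a disc
   D. Three disjoint discs of radius at least 6.5 d are never all within d of one
   point (the hole between three touching discs of radius 1 has inradius
   2 / sqrt 3 - 1 > 1 / 6.5). So at most two big discs matter near x, and there is
   a ray from x along which the distance to both grows. Follow it until D is left
   behind by d. If another disc D' is then closer than d, slide along the circle
   around D until D' is at distance exactly d; the slide is short because the lens
   between the two enlarged discs is thin. At the final point D and D' are at
   distance exactly d, hence every third disc is at distance at least d. The big
   discs lose clearance only through the slide, and these losses sum to a
   geometric series. *)

Require Import Defs.
From mathcomp Require Import all_boot all_order all_algebra.
From mathcomp Require Import all_classical all_reals all_analysis.
From mathcomp Require Import ring lra.
Import Order.TTheory GRing.Theory Num.Theory.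
Import numFieldNormedType.Exports.
Local Open Scope classical_set_scope.
Local Open Scope ring_scope.

Set Implicit Arguments.
Unset Strict Implicit.

(** * Euclidean geometry of the plane, on pairs of reals *)

Definition dot (R : realType) (p q : R * R) : R := p.1 * q.1 + p.2 * q.2.

Definition nrm (R : realType) (p : R * R) : R := Num.sqrt (dot p p).

Lemma dot_ge0 (R : realType) (p : R * R) : 0 <= dot p p.
Proof. by rewrite addr_ge0// -expr2 sqr_ge0. Qed.

Lemma nrm_ge0 (R : realType) (p : R * R) : 0 <= nrm p.
Proof. exact: sqrtr_ge0. Qed.

Lemma nrm_sqr (R : realType) (p : R * R) : nrm p ^+ 2 = dot p p.
Proof. by rewrite sqr_sqrtr// dot_ge0. Qed.

Lemma nrm_le (R : realType) (p : R * R) (t : R) :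
  0 <= t -> (nrm p <= t) = (dot p p <= t ^+ 2).
Proof. by move=> t0; rewrite -nrm_sqr ler_sqr ?nnegrE ?nrm_ge0. Qed.

Lemma nrm_eq (R : realType) (p : R * R) (t : R) :
  0 <= t -> dot p p = t ^+ 2 -> nrm p = t.
Proof. by move=> t0 pt; rewrite /nrm pt sqrtr_sqr ger0_norm. Qed.

Lemma dot_le_nrm (R : realType) (p q : R * R) : dot p q <= nrm p * nrm q.
Proof.
apply: le_trans (ler_norm _) _.
rewrite -ler_sqr ?nnegrE ?mulr_ge0 ?nrm_ge0// real_normK ?num_real//.
rewrite exprMn !nrm_sqr /dot -subr_ge0.
by rewrite [leRHS](_ : _ = (p.1 * q.2 - p.2 * q.1) ^+ 2) ?sqr_ge0//; ring.
Qed.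

Lemma nrm_triangle (R : realType) (p q : R * R) : nrm (p + q) <= nrm p + nrm q.
Proof.
rewrite nrm_le ?addr_ge0 ?nrm_ge0// sqrrD !nrm_sqr.
have := dot_le_nrm p q; rewrite /dot /=; lra.
Qed.

Lemma nrmN (R : realType) (p : R * R) : nrm (- p) = nrm p.
Proof. by congr Num.sqrt; rewrite /dot /=; ring. Qed.

Lemma nrm_dist (R : realType) (p q s : R * R) :
  nrm (p - s) <= nrm (p - q) + nrm (q - s).
Proof. by have := nrm_triangle (p - q) (q - s); rewrite subrKA. Qed.

Lemma nrm_le_l1 (R : realType) (p : R * R) : nrm p <= `|p.1| + `|p.2|.
Proof.
rewrite nrm_le ?addr_ge0// sqrrD !real_normK ?num_real//.
have : 0 <= `|p.1| * `|p.2| by rewrite mulr_ge0.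
rewrite /dot; lra.
Qed.

(** * Three disjoint discs near a common point *)

(** Three vectors cannot pairwise make angles above 120 degrees: the sum of the three unit vectors
    would have squared length below [3 - 3 = 0]. Scaling that sum by the product of the norms avoids
    division. *)
Lemma obtuse3 (R : realType) (p q s : R * R) :
  dot p q < - (nrm p * nrm q) / 2 -> dot p s < - (nrm p * nrm s) / 2 ->
  dot q s < - (nrm q * nrm s) / 2 -> False.
Proof.
have := nrm_sqr p; have := nrm_sqr q; have := nrm_sqr s.
have := nrm_ge0 p; have := nrm_ge0 q; have := nrm_ge0 s.
have := dot_le_nrm (- p) q; rewrite nrmN.
have := dot_le_nrm (- p) s; rewrite nrmN.
have := dot_le_nrm (- q) s; rewrite nrmN.
set a := nrm p; set b := nrm q; set c := nrm s.
rewrite /dot /=.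
case: p q s @a @b @c => [p1 p2] [q1 q2] [s1 s2] a b c /=.
move=> qs' ps' pq' c0 b0 a0 c2 b2 a2 pq ps qs.
(* Cauchy-Schwarz gives [- (a * b) <= dot p q < - (a * b) / 2], which forces [a * b] to be
   positive. *)
have ab : 0 < a * b by lra.
have ac : 0 < a * c by lra.
have bc : 0 < b * c by lra.
have hx := sqr_ge0 (b * c * p1 + a * c * q1 + a * b * s1).
have hy := sqr_ge0 (b * c * p2 + a * c * q2 + a * b * s2).
have e : (b * c * p1 + a * c * q1 + a * b * s1) ^+ 2
       + (b * c * p2 + a * c * q2 + a * b * s2) ^+ 2
     = (b * c) ^+ 2 * (p1 * p1 + p2 * p2) + (a * c) ^+ 2 * (q1 * q1 + q2 * q2)
     + (a * b) ^+ 2 * (s1 * s1 + s2 * s2)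
     + 2 * ((b * c) * (a * c) * (p1 * q1 + p2 * q2)
       + (b * c) * (a * b) * (p1 * s1 + p2 * s2)
       + (a * c) * (a * b) * (q1 * s1 + q2 * s2)) by ring.
have h1 : (b * c) * (a * c) * (p1 * q1 + p2 * q2)
          < (b * c) * (a * c) * (- (a * b) / 2) by rewrite ltr_pM2l// mulr_gt0.
have h2 : (b * c) * (a * b) * (p1 * s1 + p2 * s2)
          < (b * c) * (a * b) * (- (a * c) / 2) by rewrite ltr_pM2l// mulr_gt0.
have h3 : (a * c) * (a * b) * (q1 * s1 + q2 * s2)
          < (a * c) * (a * b) * (- (b * c) / 2) by rewrite ltr_pM2l// mulr_gt0.
rewrite -a2 -b2 -c2 in e.
have : (b * c * p1 + a * c * q1 + a * b * s1) ^+ 2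
       + (b * c * p2 + a * c * q2 + a * b * s2) ^+ 2 < 0.
  rewrite e; lra.
by lra.
Qed.

(** Law of cosines: seen from a point within [d] of two disjoint big discs, the centers are more
    than 120 degrees apart. *)
Lemma near_two_discs (R : realType) (d r r' : R) (p q : R * R) : 0 < d ->
  13 / 2 * d <= r -> 13 / 2 * d <= r' -> nrm p <= r + d -> nrm q <= r' + d ->
  r + r' <= nrm (p - q) -> dot p q < - (nrm p * nrm q) / 2.
Proof.
move=> d0 rd r'd pr qr' pq.
have pq2 : (r + r') ^+ 2 <= nrm (p - q) ^+ 2.
  by rewrite ler_sqr ?nnegrE ?nrm_ge0//; lra.
move: pq2; rewrite nrm_sqr.
have -> : dot (p - q) (p - q) = nrm p ^+ 2 + nrm q ^+ 2 - 2 * dot p q.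
  by rewrite !nrm_sqr /dot /=; ring.
have p0 := nrm_ge0 p; have q0 := nrm_ge0 q.
have : nrm p ^+ 2 <= (r + d) ^+ 2 by rewrite ler_sqr ?nnegrE//; lra.
have : nrm q ^+ 2 <= (r' + d) ^+ 2 by rewrite ler_sqr ?nnegrE//; lra.
have : nrm p * nrm q <= (r + d) * (r' + d) by apply: ler_pM.
(* The claim reduces to [(r - 3 * d) * (r' - 3 * d) > 12 * d ^+ 2]; the constant [13 / 2] yields
   [49 / 4 > 12]. *)
have : 7 / 2 * d * (7 / 2 * d) <= (r - 3 * d) * (r' - 3 * d).
  by apply: ler_pM; lra.
have : 0 < d * d by exact: mulr_gt0.
lra.
Qed.

Lemma no_three_near_discs (R : realType) (d r1 r2 r3 : R)
    (x c1 c2 c3 : R * R) : 0 < d ->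
  13 / 2 * d <= r1 -> 13 / 2 * d <= r2 -> 13 / 2 * d <= r3 ->
  r1 + r2 <= nrm (c1 - c2) -> r1 + r3 <= nrm (c1 - c3) ->
  r2 + r3 <= nrm (c2 - c3) ->
  nrm (x - c1) <= r1 + d -> nrm (x - c2) <= r2 + d -> nrm (x - c3) <= r3 + d ->
  False.
Proof.
move=> d0 h1 h2 h3 h12 h13 h23 x1 x2 x3.
have E (p q : R * R) : nrm (p - q) = nrm (x - p - (x - q)).
  by congr Num.sqrt; rewrite /dot /=; ring.
rewrite E in h12; rewrite E in h13; rewrite E in h23.
by apply: (@obtuse3 R (x - c1) (x - c2) (x - c3));
  [apply: near_two_discs h12|apply: near_two_discs h13
  |apply: near_two_discs h23]; eassumption.
Qed.

(** * Moving a point along a ray or along a circle *)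

Lemma direction (R : realType) (p q : R * R) :
  exists e : R * R, [/\ dot e e = 1, dot e p = 0 & 0 <= dot e q].
Proof.
have [e [e1 ep]] : exists e : R * R, dot e e = 1 /\ dot e p = 0.
  have [p0|p0] := eqVneq (nrm p) 0.
    exists (1, 0); split; first by rewrite /dot /=; ring.
    have : dot p p = 0 by rewrite -nrm_sqr p0 expr0n.
    rewrite /dot /= => /eqP; rewrite paddr_eq0 -?expr2 ?sqr_ge0//.
    by rewrite sqrf_eq0 => /andP[/eqP -> _]; ring.
  exists (- p.2 / nrm p, p.1 / nrm p); split; last by rewrite /dot /=; ring.
  have := nrm_sqr p; rewrite /dot /= => pp.
  have -> : - p.2 / nrm p * (- p.2 / nrm p) + p.1 / nrm p * (p.1 / nrm p)
     = (p.1 * p.1 + p.2 * p.2) / nrm p ^+ 2 by field.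
  by rewrite -pp divff// expf_neq0.
have [eq0|eq0] := lerP 0 (dot e q); first by exists e.
exists (- e); move: e1 ep eq0; rewrite /dot /= => e1 ep eq0.
split; lra.
Qed.

(** The exit time is the larger root [Num.sqrt D - dot e w] of a quadratic, where [dot e w] is at
    most [Num.sqrt D <= a] in absolute value. The bound improves to [a] when the ray does not head
    towards the center. *)
Lemma ray_exit (R : realType) (a : R) (w e : R * R) :
  dot e e = 1 -> nrm w < a ->
  exists s : R, [/\ 0 <= s, s <= 2 * a, (0 <= dot e w -> s <= a)
    & nrm (w + (s * e.1, s * e.2)) = a].
Proof.
move=> e1 wa; have w0 := nrm_ge0 w.
have ew2 : dot e w ^+ 2 <= dot w w.
  have : 0 <= (e.1 * w.2 - e.2 * w.1) ^+ 2 by exact: sqr_ge0.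
  have -> : (e.1 * w.2 - e.2 * w.1) ^+ 2
          = dot e e * dot w w - dot e w ^+ 2 by rewrite /dot; ring.
  by rewrite e1; lra.
have waa : dot w w < a ^+ 2.
  by rewrite -nrm_sqr ltr_sqr ?nnegrE//; lra.
pose D := dot e w ^+ 2 + a ^+ 2 - dot w w.
have D0 : 0 <= D by rewrite /D; have := sqr_ge0 (dot e w); lra.
have DD : Num.sqrt D ^+ 2 = D by rewrite sqr_sqrtr.
have Da : Num.sqrt D <= a.
  by rewrite -ler_sqr ?nnegrE ?sqrtr_ge0 ?DD /D//; lra.
have ewD : `|dot e w| <= Num.sqrt D.
  rewrite -ler_sqr ?nnegrE ?normr_ge0 ?sqrtr_ge0// DD.
  by rewrite real_normK ?num_real// /D; lra.
have := ler_norm (dot e w); have := ler_norm (- dot e w); rewrite normrN.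
move=> n1 n2; exists (Num.sqrt D - dot e w); split; try lra.
apply: nrm_eq; first by lra.
have -> : forall s, dot (w + (s * e.1, s * e.2)) (w + (s * e.1, s * e.2))
  = dot w w + 2 * s * dot e w + s ^+ 2 * dot e e.
  by move=> s; rewrite /dot /=; ring.
rewrite e1; move: DD; rewrite {2}/D => DD.
have -> : forall s, dot w w + 2 * s * dot e w + s ^+ 2 * 1
  = dot w w - dot e w ^+ 2 + (s + dot e w) ^+ 2 by move=> s; ring.
by rewrite subrK DD; ring.
Qed.

Lemma nrm_ray_ge (R : realType) (s : R) (v e : R * R) :
  0 <= s -> 0 <= dot e v -> nrm v <= nrm (v + (s * e.1, s * e.2)).
Proof.
move=> s0 ev; rewrite nrm_le ?nrm_ge0// nrm_sqr.
have -> : dot (v + (s * e.1, s * e.2)) (v + (s * e.1, s * e.2))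
  = dot v v + 2 * (s * dot e v) + s ^+ 2 * dot e e by rewrite /dot /=; ring.
have := mulr_ge0 s0 ev; have := mulr_ge0 (sqr_ge0 s) (dot_ge0 e); lra.
Qed.

(** The origin is the center of the first disc and [q] that of the second; [w'] is a point where the
    two enlarged circles cross. Coordinates are taken along [u = q / L] and its normal: [w] is
    [(p, m)], [w'] is [(P, t)]. *)
Lemma slide_on_circle (R : realType) (r r' d : R) (w q : R * R) :
  0 < d -> d <= r -> d <= r' -> nrm w = r + d -> r + r' <= nrm q ->
  nrm (w - q) < r' + d ->
  exists w' : R * R, [/\ nrm w' = r + d, nrm (w' - q) = r' + d
    & dot (w' - w) (w' - w) <= 4 * (r + d) * d].
Proof.
move=> d0 dr dr' wa qL wq.
set a := r + d in wa *; set b := r' + d in wq *.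
set L := nrm q in qL.
have L0 : 0 < L by lra.
have a0 : 0 < a by rewrite /a; lra.
have b0 : 0 < b by rewrite /b; lra.
pose u : R * R := (q.1 / L, q.2 / L).
have uu : dot u u = 1.
  have := nrm_sqr q; rewrite -/L /dot /= => qq.
  have -> : q.1 / L * (q.1 / L) + q.2 / L * (q.2 / L)
     = (q.1 * q.1 + q.2 * q.2) / L ^+ 2 by field; rewrite gt_eqF.
  by rewrite -qq divff// expf_neq0// gt_eqF.
have qE : q = (L * u.1, L * u.2).
  by rewrite /u /= ![L * _]mulrC !divfK ?gt_eqF//; case: (q).
pose p := dot w u; pose m := u.1 * w.2 - u.2 * w.1.
have wE : w = (p * u.1 - m * u.2, p * u.2 + m * u.1).
  rewrite (_ : _ - _ = dot u u * w.1); last by rewrite /p /m /dot; ring.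
  rewrite (_ : _ + _ = dot u u * w.2); last by rewrite /p /m /dot; ring.
  by rewrite uu !mul1r; case: (w).
have frame (s t : R) :
    dot (s * u.1 - t * u.2, s * u.2 + t * u.1)
        (s * u.1 - t * u.2, s * u.2 + t * u.1) = s ^+ 2 + t ^+ 2.
  rewrite -[RHS]mulr1 -uu /dot /=; ring.
have pm : p ^+ 2 + m ^+ 2 = a ^+ 2 by rewrite -frame -wE -nrm_sqr wa.
have distq (s t : R) :
    dot ((s * u.1 - t * u.2, s * u.2 + t * u.1) - q)
        ((s * u.1 - t * u.2, s * u.2 + t * u.1) - q)
    = s ^+ 2 + t ^+ 2 + L ^+ 2 - 2 * L * s.
  have -> : s ^+ 2 + t ^+ 2 + L ^+ 2 - 2 * L * s
    = (s ^+ 2 + t ^+ 2 + L ^+ 2 - 2 * L * s) * dot u u by rewrite uu mulr1.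
  by rewrite qE /dot /=; ring.
have wqb : p ^+ 2 + m ^+ 2 + L ^+ 2 - 2 * L * p < b ^+ 2.
  rewrite -distq -wE -nrm_sqr ltr_sqr ?nnegrE ?nrm_ge0//; exact: ltW.
pose P := (a ^+ 2 + L ^+ 2 - b ^+ 2) / (2 * L).
have LP : 2 * L * P = a ^+ 2 + L ^+ 2 - b ^+ 2.
  by rewrite /P mulrC divfK// gt_eqF// mulr_gt0.
have Pp : P < p by rewrite -(@ltr_pM2l _ (2 * L)) ?mulr_gt0//; lra.
have pa : p <= a.
  apply: le_trans (ler_norm _) _; rewrite -ler_sqr ?nnegrE ?(ltW a0)//.
  by rewrite real_normK ?num_real//; have := sqr_ge0 m; lra.
have aP : - a <= P.
  rewrite -(@ler_pM2l _ (2 * L)) ?mulr_gt0// LP.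
  have : b ^+ 2 <= (a + L) ^+ 2 by rewrite ler_sqr ?nnegrE /a /b; lra.
  lra.
(* The lens is thin: [2 * L * (a - P) = b ^+ 2 - (L - a) ^+ 2 <= 4 * r' * d]. *)
have aPd : a - P <= 2 * d.
  rewrite -(@ler_pM2l _ (2 * L)) ?mulr_gt0// mulrBr LP.
  have : (r' - d) ^+ 2 <= (L - a) ^+ 2 by rewrite ler_sqr ?nnegrE /a; lra.
  have : r' * d <= L * d by rewrite ler_pM2r//; lra.
  rewrite /b; lra.
have P2 : 0 <= a ^+ 2 - P ^+ 2.
  rewrite subr_sqr mulr_ge0//; lra.
pose T := Num.sqrt (a ^+ 2 - P ^+ 2).
have T0 : 0 <= T by exact: sqrtr_ge0.
have TT : T ^+ 2 = a ^+ 2 - P ^+ 2 by rewrite sqr_sqrtr.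
(* Of the two crossing points, the one on the same side of the axis as [w]. *)
have [t [tT tm]] : exists t : R, t ^+ 2 = T ^+ 2 /\ t * m = T * `|m|.
  have [m0|m0] := lerP 0 m; first by exists T; rewrite ger0_norm.
  by exists (- T); rewrite sqrrN ltr0_norm// mulrN mulNr.
(* On the circle, [w] lies between the axis point [(a, 0)] and [w'], so the angle from [w] to [w']
   is at most that from the axis to [w']. *)
have key : a * P <= p * P + T * `|m|.
  have mm : `|m| ^+ 2 = a ^+ 2 - p ^+ 2 by rewrite real_normK ?num_real//; lra.
  have m0 := normr_ge0 m.
  have [P0|P0] := lerP P 0.
    have := mulr_ge0 T0 m0.
    have : 0 <= (a - p) * (- P) by rewrite mulr_ge0//; lra.
    lra.
  have mT : `|m| <= T.
    rewrite -ler_sqr ?nnegrE// mm TT lerD2l lerN2 ler_sqr ?nnegrE; lra.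
  have : `|m| * `|m| <= T * `|m| by rewrite ler_wpM2r.
  rewrite -expr2 mm.
  have : 0 <= (a - p) * (a + p - P) by rewrite mulr_ge0//; lra.
  lra.
exists (P * u.1 - t * u.2, P * u.2 + t * u.1); split.
- by apply: nrm_eq; rewrite ?frame ?ltW// tT TT; ring.
- apply: nrm_eq; rewrite ?ltW// distq tT TT; lra.
- rewrite [X in _ - X]wE.
  have -> : (P * u.1 - t * u.2, P * u.2 + t * u.1)
           - (p * u.1 - m * u.2, p * u.2 + m * u.1)
      = ((P - p) * u.1 - (t - m) * u.2, (P - p) * u.2 + (t - m) * u.1).
    by apply/pair_equal_spec; split=> /=; ring.
  rewrite frame.
  have -> : (P - p) ^+ 2 + (t - m) ^+ 2
    = P ^+ 2 + p ^+ 2 + t ^+ 2 + m ^+ 2 - 2 * (p * P + t * m) by ring.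
  rewrite tm tT TT.
  have : 2 * a * (a - P) <= 2 * a * (2 * d) by rewrite ler_pM2l// mulr_gt0.
  lra.
Qed.

(** * Clearance from a disc packing, scale by scale *)

Definition disc_packing (R : realType) (I : Type) (c : I -> R * R)
    (r : I -> R) : Prop :=
  (forall i, 0 < r i) /\
  (forall i j, i <> j -> r i + r j <= nrm (c i - c j)).

(** With [t = k * r i] this says that [x] avoids the interior of the disc enlarged by [1 + k]. *)
Definition clear (R : realType) (I : Type) (c : I -> R * R) (r : I -> R)
    (x : R * R) (t : R) (i : I) : Prop :=
  r i + t <= nrm (x - c i).

(* The clearance [rho] from all discs of radius at least [13 / 2 * rho] is not
   scale invariant for a fixed disc, so a clearance proportional to the radius is
   recorded once the radius exceeds [182 * rho], together with a reserve
   ([3 / 5 * rho], or [14 * rho] when the disc is out of reach of the next move)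
   that pays for all the later moves. *)
Definition clear_at_scale (R : realType) (I : Type) (c : I -> R * R)
    (r : I -> R) (k : R) (x : R * R) (rho : R) : Prop :=
  forall i, (13 / 2 * rho <= r i -> clear c r x rho i) /\
    (182 * rho <= r i -> clear c r x (2 * k * r i + 3 / 5 * rho) i \/
                         clear c r x (k * r i + 14 * rho) i).

Lemma nearby_clear (R : realType) (I : Type) (c : I -> R * R) (r : I -> R)
    (x y : R * R) (s t : R) (i : I) :
  clear c r x t i -> nrm (y - x) <= t - s -> clear c r y s i.
Proof.
rewrite /clear => xt yx; have := nrm_dist x y (c i).
by rewrite -[nrm (x - y)]nrmN opprB; lra.
Qed.

Lemma clear_weaken (R : realType) (I : Type) (c : I -> R * R) (r : I -> R)
    (x : R * R) (s t : R) (i : I) :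
  clear c r x t i -> s <= t -> clear c r x s i.
Proof. by rewrite /clear; lra. Qed.

(** Bookkeeping of the reserves. A near big disc loses at most [117/200 * rho], and
    [3/5 - 117/200 = 3/200] still exceeds the next reserve [3/5 * 1/80]. A far disc may lose the
    whole length of the move. *)
Lemma scale_transfer (R : realType) (I : Type) (c : I -> R * R) (r : I -> R)
    (k rho : R) (x y : R * R) :
  (forall i, 0 < r i) -> 0 < k -> k * (182 * 400) <= 1 -> 0 < rho ->
  clear_at_scale c r k x rho ->
  (forall i, 13 / 2 * (rho / 80) <= r i -> r i < 182 * rho ->
     clear c r y (rho / 80) i) ->
  (forall i t, 182 * rho <= r i -> ~ clear c r x (k * r i + 14 * rho) i ->
     clear c r x t i -> clear c r y (t - 117 / 200 * rho) i) ->
  nrm (y - x) <= 14 * (79 / 80) * rho ->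
  clear_at_scale c r k y (rho / 80).
Proof.
move=> r0 k0 k1 rho0 xS small big xy i.
have kr : 0 < k * r i by rewrite mulr_gt0.
have [ri|ri] := ltrP (r i) (182 * rho).
  split=> [?|ri']; first exact: small.
  (* The bound on [k] gives [2 * k * r i <= 2/5 * (rho / 80)], which leaves exactly the reserve
     [3/5 * (rho / 80)]. *)
  left; apply: clear_weaken (small i _ ri) _; first by lra.
  have : k * r i <= k * (182 * rho) by rewrite ler_pM2l// ltW.
  have : k * (182 * 400) * rho <= 1 * rho by rewrite ler_pM2r.
  lra.
have [x1 x2] := xS i.
have {}x1 : clear c r x rho i by apply: x1; lra.
have [far|near] := pselect (clear c r x (k * r i + 14 * rho) i).
  have {}far : clear c r y (k * r i + 14 * (rho / 80)) i.
    by apply: nearby_clear far _; lra.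
  split=> _; last by right.
  by apply: clear_weaken far _; lra.
split=> _.
  by apply: clear_weaken (big i _ ri near x1) _; lra.
left; have [x3|//] := x2 ri.
by apply: clear_weaken (big i _ ri near x3) _; lra.
Qed.

(* The two clearances recorded for a big disc [i] within
   [k * r i + 14 * rho] give [k * r i < 14 * rho], so the disc is within
   [28 * rho], while [182 * rho = 13 / 2 * (28 * rho)]. *)
Lemma no_three_near_big_discs (R : realType) (I : Type) (c : I -> R * R) (r : I -> R)
    (k rho : R) (x : R * R) :
  disc_packing c r -> 0 < k -> 0 < rho -> clear_at_scale c r k x rho ->
  forall i j l, i <> j -> i <> l -> j <> l ->
  (forall m, m = i \/ m = j \/ m = l ->
    182 * rho <= r m /\ ~ clear c r x (k * r m + 14 * rho) m) -> False.
Proof.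
move=> [r0 sep] k0 rho0 xS i j l ij il jl rel.
have near m : m = i \/ m = j \/ m = l ->
    13 / 2 * (28 * rho) <= r m /\ nrm (x - c m) <= r m + 28 * rho.
  move=> /rel[rm nm]; split; first by lra.
  have [_ /(_ rm)[|//]] := xS m.
  by move: nm; rewrite /clear => /negP; rewrite -ltNge; lra.
have [i1 i2] := near i (or_introl erefl).
have [j1 j2] := near j (or_intror (or_introl erefl)).
have [l1 l2] := near l (or_intror (or_intror erefl)).
apply: (@no_three_near_discs _ (28 * rho) (r i) (r j) (r l) x (c i) (c j) (c l));
  rewrite ?sep//; lra.
Qed.

(** At most two big discs are near. The direction is orthogonal to the line to one of them and does
    not approach the other. Without big discs it is free to point away along [w], which shortens the
    first move. *)
Lemma escape_direction (R : realType) (I : Type) (c : I -> R * R) (r : I -> R)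
    (k rho : R) (x w : R * R) :
  disc_packing c r -> 0 < k -> 0 < rho -> clear_at_scale c r k x rho ->
  exists e : R * R, [/\ dot e e = 1,
    (forall i, 182 * rho <= r i -> ~ clear c r x (k * r i + 14 * rho) i ->
       0 <= dot e (x - c i)) &
    ((forall i, r i < 182 * rho) -> 0 <= dot e w)].
Proof.
move=> pk k0 rho0 xS.
pose rel i := 182 * rho <= r i /\ ~ clear c r x (k * r i + 14 * rho) i.
have [[i reli]|none] := pselect (exists i, rel i); last first.
  have [e [e1 _ ew]] := direction 0 w; exists e; split=> // i ri ni.
  by case: none; exists i.
have [[j [ij relj]]|none] := pselect (exists j, i <> j /\ rel j).
  have [e [e1 ei ej]] := direction (x - c i) (x - c j).
  exists e; split=> // [l rl nl|small]; last by have [+ _] := reli; rewrite leNgt small.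
  have [->|il] := pselect (l = i); first by rewrite ei.
  have [->//|jl] := pselect (l = j).
  exfalso; apply: (no_three_near_big_discs pk k0 rho0 xS (i := i) (j := j) (l := l)).
  - by [].
  - by move=> li; apply: il.
  - by move=> lj; apply: jl.
  - by move=> m [->//|[->//|->]].
have [e [e1 ei _]] := direction (x - c i) w.
exists e; split=> // [l rl nl|small]; last by have [+ _] := reli; rewrite leNgt small.
have [->|il] := pselect (l = i); first by rewrite ei.
by case: none; exists l; split=> // li; apply: il.
Qed.

Lemma next_scale (R : realType) (I : Type) (c : I -> R * R) (r : I -> R)
    (k rho : R) (x : R * R) :
  disc_packing c r -> 0 < k -> k * (182 * 400) <= 1 -> 0 < rho ->
  clear_at_scale c r k x rho ->
  exists y : R * R, [/\ clear_at_scale c r k y (rho / 80),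
    nrm (y - x) <= 14 * rho &
    ((forall i, r i < 182 * rho) -> nrm (y - x) <= 8 * rho)].
Proof.
move=> pk k0 k1 rho0 xS; have [r0 sep] := pk.
have d0 : 0 < rho / 80 by lra.
have [|] := pselect (forall i, 13 / 2 * (rho / 80) <= r i ->
                       clear c r x (rho / 80) i).
  have xx : nrm (x - x) = 0.
    by rewrite subrr; apply: nrm_eq => //; rewrite /dot /=; ring.
  move=> xC; exists x; split=> [|| _]; rewrite ?xx; [|lra..].
  apply: (scale_transfer r0 k0 k1 rho0 xS) => [i ri _|i t _ _ xt|].
  - exact: xC.
  - by apply: clear_weaken xt _; lra.
  - by rewrite xx; lra.
move=> /existsNP[D /not_implyP[rD /negP]]; rewrite /clear -ltNge => xD.
have rD' : r D < 13 / 2 * rho.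
  rewrite ltNge; apply/negP => /(proj1 (xS D)); rewrite /clear; lra.
have [e [e1 eH eD]] := escape_direction (x - c D) pk k0 rho0 xS.
have [s [s0 s2a sa yD]] := ray_exit e1 xD.
pose y := x + (s * e.1, s * e.2).
have {}yD : nrm (y - c D) = r D + rho / 80 by rewrite -yD /y addrAC.
have yxs : nrm (y - x) = s.
  apply: nrm_eq => //; rewrite /y addrC addKr.
  rewrite (_ : dot _ _ = s ^+ 2 * dot e e); last by rewrite /dot /=; ring.
  by rewrite e1 mulr1.
(* Near big discs lose nothing along the ray, so only the slide is charged to their reserve. *)
have yH i t : 182 * rho <= r i -> ~ clear c r x (k * r i + 14 * rho) i ->
    clear c r x t i -> clear c r y t i.
  move=> ri ni; rewrite /clear => /le_trans; apply.
  by rewrite /y [_ + _ - _]addrAC; apply: nrm_ray_ge => //; exact: eH.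
(* Since [r D < 13/2 * rho], the ray part is at most [13.025 * rho], or [6.5125 * rho] without big
   discs. The slide is at most [sqrt (4 * 6.5125 / 80) * rho], below [0.585 * rho]. The totals stay
   under [14 * (79/80) * rho] and [8 * rho]. *)
suff [z [zs zy]] : exists z, (forall i, 13 / 2 * (rho / 80) <= r i ->
     r i < 182 * rho -> clear c r z (rho / 80) i) /\
     nrm (z - y) <= 117 / 200 * rho.
  have zx := nrm_dist z y x; rewrite yxs in zx.
  exists z; split=> [||small]; [|lra|]; last first.
    by have /sa := eD small; lra.
  apply: (scale_transfer r0 k0 k1 rho0 xS) => //; last by lra.
  move=> i t ri ni /(yH _ _ ri ni) yt; apply: nearby_clear yt _; lra.
have [yC|] := pselect (forall i, 13 / 2 * (rho / 80) <= r i ->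
     r i < 182 * rho -> clear c r y (rho / 80) i).
  exists y; split=> //; rewrite subrr nrm_le; last by lra.
  by rewrite (_ : dot _ _ = 0) ?sqr_ge0// /dot /=; ring.
move=> /existsNP[D2 /not_implyP[rD2 /not_implyP[_ /negP]]].
rewrite /clear -ltNge => yD2.
have DD2 : D <> D2 by move=> DD2; move: yD2; rewrite -DD2 yD ltxx.
have cE (u : R * R) : u - c D2 = u - c D - (c D2 - c D).
  by rewrite opprB addrA subrK.
have qL : r D + r D2 <= nrm (c D2 - c D) by rewrite -nrmN opprB sep.
rewrite cE in yD2.
have [||w' [w1 w2 w3]] := slide_on_circle d0 _ _ yD qL yD2; [lra..|].
pose z := w' + c D.
have zw : w' = z - c D by rewrite /z addrK.
rewrite zw in w1 w2 w3; rewrite -cE in w2.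
exists z; split; last first.
  rewrite nrm_le; last by lra.
  move: w3; rewrite opprB addrA subrK => /le_trans; apply.
  have : (r D + rho / 80) * rho <= (13 / 2 * rho + rho / 80) * rho.
    by rewrite ler_pM2r//; lra.
  have : 0 < rho ^+ 2 by rewrite exprn_gt0.
  lra.
move=> i ri _; have [->|iD] := pselect (i = D); first by rewrite /clear w1.
have [->|iD2] := pselect (i = D2); first by rewrite /clear w2.
rewrite /clear leNgt; apply/negP => zi.
apply: (@no_three_near_discs _ (rho / 80) (r D) (r D2) (r i) z
  (c D) (c D2) (c i)) => //; rewrite ?sep ?w1 ?w2 ?lexx ?(ltW zi)//.
- by move=> Di; apply: iD.
- by move=> Di; apply: iD2.
Qed.

(** * Passage to the limit over all scales *)

(** The intervals of radius [15 * rho n] around [u n] are nested because [14 + 15/80 <= 15]; the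
    supremum of their left ends lies in all of them. *)
Lemma geometric_limit (R : realType) (u rho : nat -> R) :
  (forall n, 0 <= rho n) -> (forall n, rho n.+1 = rho n / 80) ->
  (forall n, `|u n.+1 - u n| <= 14 * rho n) ->
  exists l : R, forall n, `|l - u n| <= 15 * rho n.
Proof.
move=> rho0 rhoS uS.
pose lo n := u n - 15 * rho n; pose hi n := u n + 15 * rho n.
have lo_incr : {homo lo : n m / (n <= m)%N >-> n <= m}.
  apply/nondecreasing_seqP => n; rewrite /lo rhoS.
  by have := uS n; rewrite ler_norml => /andP[]; have := rho0 n; lra.
have hi_decr : {homo hi : n m / (n <= m)%N >-> m <= n}.
  apply/nonincreasing_seqP => n; rewrite /hi rhoS.
  by have := uS n; rewrite ler_norml => /andP[]; have := rho0 n; lra.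
have lo_hi n m : lo n <= hi m.
  apply: (@le_trans _ _ (lo (maxn n m))); first exact/lo_incr/leq_maxl.
  apply: (@le_trans _ _ (hi (maxn n m))); last exact/hi_decr/leq_maxr.
  by rewrite /lo /hi; have := rho0 (maxn n m); lra.
exists (sup (range lo)) => n.
have lo_sup : lo n <= sup (range lo).
  apply: ub_le_sup; last by exists n.
  by exists (hi n) => _ [m _ <-].
have sup_hi : sup (range lo) <= hi n.
  by apply: ge_sup; [exists (lo 0); exists 0|move=> _ [m _ <-]].
by rewrite ler_norml; move: lo_sup sup_hi; rewrite /lo /hi; lra.
Qed.

Lemma geometric_small (R : realType) (e : R) :
  0 < e -> exists n, 80^-1 ^+ n < e.
Proof.
move=> e0; exists (Num.bound e^-1).
rewrite exprVn invf_plt ?posrE ?exprn_gt0//.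
apply: lt_le_trans (archi_boundP _) _; first by rewrite invr_ge0 ltW.
by rewrite -natrX ler_nat ltnW// ltn_expl.
Qed.

(* The first scale [4 / 25] exceeds [2 / 13], so that initially there is nothing
   to be clear of. *)
Lemma point_away_from_discs (R : realType) (I : Type) (c : I -> R * R)
    (r : I -> R) (k : R) (m : R * R) :
  disc_packing c r -> (forall i, r i <= 1) -> 0 < k -> k * (182 * 400) <= 1 ->
  exists x : R * R, nrm (x - m) <= 2 /\ forall i, clear c r x (k * r i) i.
Proof.
move=> pk r1 k0 k1; have [r0 _] := pk.
(* The move becomes a total function, with the default value [0] where the hypotheses fail. *)
have /choice[f fP] : forall p : (R * R) * R, exists y, 0 < p.2 ->
    clear_at_scale c r k p.1 p.2 ->
    [/\ clear_at_scale c r k y (p.2 / 80), nrm (y - p.1) <= 14 * p.2 &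
    ((forall i, r i < 182 * p.2) -> nrm (y - p.1) <= 8 * p.2)].
  move=> p.
  have [p0|p0] := pselect (0 < p.2); last by exists 0.
  have [pS|pS] := pselect (clear_at_scale c r k p.1 p.2); last by exists 0.
  by have [y yP] := next_scale pk k0 k1 p0 pS; exists y.
pose rho n : R := 4 / 25 * 80^-1 ^+ n.
have rho_gt0 n : 0 < rho n by rewrite mulr_gt0 ?exprn_gt0//; lra.
have rhoS n : rho n.+1 = rho n / 80 by rewrite /rho exprSr mulrA.
have rho0 : rho 0 = 4 / 25 by rewrite /rho expr0 mulr1.
pose fix xs n := if n is n'.+1 then f (xs n', rho n') else m.
have xsS n : clear_at_scale c r k (xs n) (rho n).
  elim: n => [i|n IH]; last by rewrite rhoS; have [] := fP (xs n, rho n) (rho_gt0 n) IH.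
  by rewrite rho0; have := r1 i; split=> ?; exfalso; lra.
have step n : nrm (xs n.+1 - xs n) <= 14 * rho n.
  by have [] := fP (xs n, rho n) (rho_gt0 n) (xsS n).
(* All radii are below [182 * rho 0], so the sharper bound [1.28] applies; the general one,
   [14 * rho 0 = 2.24], would leave the disc of radius 2. *)
have step0 : nrm (xs 1 - m) <= 8 * rho 0.
  have [_ _] := fP (xs 0, rho 0) (rho_gt0 0) (xsS 0); apply=> i /=.
  by rewrite rho0; have := r1 i; lra.
have coord (p : R * R) : `|p.1| <= nrm p /\ `|p.2| <= nrm p.
  split; rewrite -ler_sqr ?nnegrE ?nrm_ge0// nrm_sqr real_normK ?num_real//.
    by rewrite /dot; have := sqr_ge0 p.2; lra.
  by rewrite /dot; have := sqr_ge0 p.1; lra.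
have [n|a aP] := @geometric_limit _ (fun n => (xs n).1) rho
  (fun n => ltW (rho_gt0 n)) rhoS.
  exact: le_trans (proj1 (coord (xs n.+1 - xs n))) (step n).
have [n|b bP] := @geometric_limit _ (fun n => (xs n).2) rho
  (fun n => ltW (rho_gt0 n)) rhoS.
  exact: le_trans (proj2 (coord (xs n.+1 - xs n))) (step n).
have lim n : nrm ((a, b) - xs n) <= 30 * rho n.
  apply: le_trans (nrm_le_l1 _) _ => /=; have := aP n; have := bP n; lra.
exists (a, b); split=> [|i].
  have := nrm_dist (a, b) (xs 1) m; have := lim 1%N; rewrite rhoS.
  by move: step0; rewrite rho0; lra.
have kr : 0 < k * r i by rewrite mulr_gt0.
rewrite /clear leNgt; apply/negP => ab.
pose gap := r i + k * r i - nrm ((a, b) - c i).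
(* At a scale this fine, [xs n] already records the clearance [k * r i] and is within [gap] of the
   limit. The factor 30 serves both bounds, as [182 * (4/25) < 30]. *)
have [n] : exists n, 80^-1 ^+ n < Num.min gap (r i) / 30.
  by apply: geometric_small; rewrite divr_gt0// lt_min r0 andbT /gap; lra.
rewrite ltr_pdivlMr// lt_min => /andP[ngap nr].
have {}ngap : 30 * rho n < gap.
  by apply: le_lt_trans ngap; rewrite /rho; have := rho_gt0 n; rewrite /rho; lra.
have {}nr : 182 * rho n <= r i.
  by apply: le_trans (ltW nr); rewrite /rho; have := rho_gt0 n; rewrite /rho; lra.
have xi : r i + k * r i <= nrm (xs n - c i).
  have [_ /(_ nr)[]] := xsS n i; rewrite /clear; have := rho_gt0 n; lra.
have := nrm_dist (xs n) (a, b) (c i); rewrite -[nrm (xs n - (a, b))]nrmN opprB.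
by have := lim n; move: ngap; rewrite /gap; lra.
Qed.

(** * Transfer to row vectors: discs as sets, and squares *)

Definition pt (R : realType) (v : 'rV[R]_2) : R * R := (v 0 0, v 0 1).

Lemma ptD (R : realType) (u v : 'rV[R]_2) : pt (u + v) = pt u + pt v.
Proof. by rewrite /pt !mxE. Qed.

Lemma ptB (R : realType) (u v : 'rV[R]_2) : pt (u - v) = pt u - pt v.
Proof. by rewrite /pt !mxE. Qed.

Lemma dotv_pt (R : realType) (u v : 'rV[R]_2) : dotv u v = dot (pt u) (pt v).
Proof.
rewrite /dotv !big_ord_recl big_ord0 addr0 /dot /=.
by rewrite (_ : lift ord0 ord0 = 1) //; apply: val_inj.
Qed.

Lemma enorm_pt (R : realType) (v : 'rV[R]_2) : enorm v = nrm (pt v).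
Proof. by rewrite /enorm dotv_pt. Qed.

Lemma enormZ (R : realType) (n : nat) (a : R) (v : 'rV[R]_n) :
  enorm (a *: v) = `|a| * enorm v.
Proof.
rewrite -sqrtr_sqr /enorm -sqrtrM ?sqr_ge0//; congr Num.sqrt.
by rewrite /dotv mulr_sumr; apply: eq_bigr => i _; rewrite !mxE; ring.
Qed.

Lemma interior_disc (R : realType) (c x : 'rV[R]_2) (r : R) :
  nrm (pt x - pt c) < r -> interior (disc c r) x.
Proof.
move=> xr; apply/nbhs_ballP.
(* Halved because balls here are for the sup norm, and the Euclidean norm is at most the sum of two
   coordinates. *)
exists ((r - nrm (pt x - pt c)) / 2); first by rewrite /= divr_gt0// subr_gt0.
move=> y [_ xy]; rewrite /disc /closed_ball_ /= enorm_pt ptB.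
rewrite -nrmN opprB.
apply: le_trans (nrm_dist _ (pt x) _) _.
have := nrm_le_l1 (pt x - pt y); rewrite -[nrm (pt x - _)]nrmN opprB /=.
have := xy 0 0; have := xy 0 1; rewrite /ball /=; lra.
Qed.

Lemma interior_discs_meet (R : realType) (c c' : 'rV[R]_2) (r r' : R) :
  0 < r -> 0 < r' -> nrm (pt c - pt c') < r + r' ->
  interior (disc c r) `&` interior (disc c' r') !=set0.
Proof.
move=> r0 r'0 cc; have rr : 0 < r + r' by rewrite addr_gt0.
have rr0 : r + r' != 0 by rewrite gt_eqF.
(* The point dividing the segment of centers in the ratio [r : r']. *)
exists (c + (r / (r + r')) *: (c' - c)); split; apply: interior_disc.
  rewrite -ptB -enorm_pt addrC addKr enormZ ger0_norm ?divr_ge0 ?ltW//.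
  by rewrite enorm_pt ptB -nrmN opprB mulrAC ltr_pdivrMr// ltr_pM2l.
rewrite -ptB -enorm_pt (_ : _ - c' = (r' / (r + r')) *: (c - c')).
  rewrite enormZ ger0_norm ?divr_ge0 ?ltW//.
  by rewrite enorm_pt ptB mulrAC ltr_pdivrMr// ltr_pM2l.
by apply/rowP => i; rewrite !mxE; field.
Qed.

(** Reflecting in [c'] the boundary point opposite to [c'] gives a point at distance [r + 2 * N]
    from [c], outside the disc unless [N = 0]. *)
Lemma symmetry_center_disc (R : realType) (c c' : 'rV[R]_2) (r : R) :
  0 < r -> symmetry_center (disc c r) c' -> c' = c.
Proof.
move=> r0 sym; apply/eqP; rewrite -subr_eq0; apply/negPn/negP => cc.
pose N := enorm (c' - c).
have N0 : 0 < N.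
  rewrite lt_neqAle sqrtr_ge0 andbT eq_sym; apply: contra cc.
  rewrite sqrtr_eq0 dotv_pt => N0.
  have : dot (pt (c' - c)) (pt (c' - c)) = 0 by apply/le_anti; rewrite N0 dot_ge0.
  rewrite /dot => /eqP; rewrite paddr_eq0 -?expr2 ?sqr_ge0// !sqrf_eq0 /=.
  move=> /andP[/eqP e0 /eqP e1]; apply/eqP/rowP => i; rewrite [RHS]mxE.
  case: i => [[|[|//]] i2]; [rewrite -[RHS]e0|rewrite -[RHS]e1];
  by congr (_ _ _); apply: val_inj.
have := sym (c - (r / N) *: (c' - c)); rewrite /disc /closed_ball_ /=.
have rN : 0 <= r / N by rewrite divr_ge0// ltW.
rewrite opprB addrC subrK enormZ ger0_norm//.
rewrite -/N divfK ?gt_eqF// lexx => /(_ isT).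
rewrite (_ : c - _ = - (2 + r / N) *: (c' - c)); last first.
  by apply/rowP => i; rewrite !mxE; ring.
rewrite enormZ normrN ger0_norm; last by rewrite addr_ge0.
by rewrite -/N mulrDl divfK ?gt_eqF//; lra.
Qed.

(** Cauchy-Schwarz bounds the coordinates of [x] relative to the midpoint of the square by [1/2]. *)
Lemma square_contains_disc (R : realType) (p u v : R * R) (a : R) (x : R * R) :
  0 < a -> dot u u = a ^+ 2 -> dot v v = a ^+ 2 -> dot u v = 0 ->
  nrm (x - (p + ((u.1 + v.1) / 2, (u.2 + v.2) / 2))) <= a / 2 ->
  exists s t : R, [/\ 0 <= s <= 1, 0 <= t <= 1 &
    x = p + (s * u.1, s * u.2) + (t * v.1, t * v.2)].
Proof.
move=> a0 uu vv uv; set w := x - _ => wa.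
have bound (z : R * R) : dot z z = a ^+ 2 -> `|dot w z| <= a ^+ 2 / 2.
  move=> zz; have za : nrm z = a by apply: nrm_eq => //; exact: ltW.
  have h (y : R * R) : nrm y <= a / 2 -> dot y z <= a ^+ 2 / 2.
    move=> ya; apply: le_trans (dot_le_nrm _ _) _; rewrite za.
    by rewrite expr2 mulrAC ler_pM2r.
  rewrite ler_norml h// andbT lerNl -[- _](_ : dot (- w) z = _).
    by apply: h; rewrite nrmN.
  by rewrite /dot /=; ring.
have range01 (y : R) : `|y| <= a ^+ 2 / 2 -> 0 <= 1 / 2 + y / a ^+ 2 <= 1.
  have aa : 0 < a ^+ 2 by rewrite exprn_gt0.
  rewrite ler_norml => /andP[y1 y2].
  have : y / a ^+ 2 <= 1 / 2 by rewrite ler_pdivrMr//; lra.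
  have : - (1 / 2) <= y / a ^+ 2 by rewrite ler_pdivlMr//; lra.
  lra.
exists (1 / 2 + dot w u / a ^+ 2), (1 / 2 + dot w v / a ^+ 2).
split; [exact/range01/bound..|].
(* [v] is [u] turned by a right angle, and [D / a ^+ 2], equal to 1 or -1, is the sense of the turn.
   The next identities hold modulo [dot u v = 0]. *)
pose D := u.1 * v.2 - u.2 * v.1.
have v1 : v.1 * a ^+ 2 = - u.2 * D.
  rewrite -uu (_ : - u.2 * D = - u.2 * D + u.1 * dot u v); last by rewrite uv; ring.
  by rewrite /D /dot; ring.
have v2 : v.2 * a ^+ 2 = u.1 * D.
  rewrite -uu (_ : u.1 * D = u.1 * D + u.2 * dot u v); last by rewrite uv; ring.
  by rewrite /D /dot; ring.
have DD : D ^+ 2 = a ^+ 2 * a ^+ 2.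
  rewrite -{1}uu -vv (_ : D ^+ 2 = D ^+ 2 + dot u v ^+ 2).
    by rewrite /D /dot; ring.
  by rewrite uv; ring.
have a20 : a ^+ 2 != 0 by rewrite expf_neq0// gt_eqF.
have frame (i j : R) : dot (i, j) u * u.1 + dot (i, j) v * v.1 = a ^+ 2 * i
  /\ dot (i, j) u * u.2 + dot (i, j) v * v.2 = a ^+ 2 * j.
  have [e1 e2] : v.1 = - u.2 * (D / a ^+ 2) /\ v.2 = u.1 * (D / a ^+ 2).
    by split; apply: (mulIf a20); rewrite -[RHS]mulrA divfK.
  have d2 : (D / a ^+ 2) ^+ 2 = 1.
    by rewrite expr_div_n DD -expr2 divff// expf_neq0.
  move: e1 e2 d2; set d := D / _ => e1 e2 d2.
  have uE : a ^+ 2 = u.1 ^+ 2 + u.2 ^+ 2 by rewrite -uu /dot; ring.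
  split.
    transitivity (u.1 * (i * u.1 + j * u.2)
       + u.2 * (i * u.2 - j * u.1) * d ^+ 2).
      by rewrite /dot /= e1 e2; ring.
    by rewrite d2 uE; ring.
  transitivity (u.2 * (i * u.1 + j * u.2)
     + u.1 * (j * u.1 - i * u.2) * d ^+ 2).
    by rewrite /dot /= e1 e2; ring.
  by rewrite d2 uE; ring.
have [f1 f2] := frame w.1 w.2; rewrite -surjective_pairing in f1 f2.
have xw : x = w + (p + ((u.1 + v.1) / 2, (u.2 + v.2) / 2)) by rewrite /w subrK.
have w1 : w.1 = (dot w u * u.1 + dot w v * v.1) / a ^+ 2.
  by rewrite f1 mulrAC divff// mul1r.
have w2 : w.2 = (dot w u * u.2 + dot w v * v.2) / a ^+ 2.
  by rewrite f2 mulrAC divff// mul1r.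
rewrite [LHS]xw; apply/pair_equal_spec; split => /=.
  by rewrite [X in X + _ = _]w1; field; rewrite gt_eqF.
by rewrite [X in X + _ = _]w2; field; rewrite gt_eqF.
Qed.

(** * The theorem for a packing given as a set of bodies *)

Unset Implicit Arguments.
Set Strict Implicit.

Theorem theorem2 (R : realType) (C : set (set 'rV[R]_2))
  (packC : packing C)
  (discC : forall B : set 'rV[R]_2, C B ->
     exists (c : 'rV[R]_2) (r : R), 0 < r <= 1 /\ B = disc c r)
  (S : set 'rV[R]_2) (sqS : is_square 4 S) :
  ~ covers (enlargement (10 ^- 5) C) S.
Proof.
have /choice[f fP] : forall B, exists cr : 'rV[R]_2 * R, C B ->
    0 < cr.2 <= 1 /\ B = disc cr.1 cr.2.
  move=> B; have [CB|] := pselect (C B); last by exists (0, 0).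
  by have [c [r ?]] := discC B CB; exists (c, r).
(* Indexing by the members themselves makes distinct indices distinct bodies. *)
pose I := {B | C B}.
pose c (i : I) := pt (f (sval i)).1; pose r (i : I) := (f (sval i)).2.
have rP (i : I) : 0 < r i <= 1 by have [] := fP _ (svalP i).
have pk : disc_packing c r.
  split=> [i|i j ij]; first by have /andP[] := rP i.
  rewrite leNgt; apply/negP => meet; apply: ij.
  have /andP[ri0 _] := rP i; have /andP[rj0 _] := rP j.
  have := interior_discs_meet ri0 rj0 meet.
  have [_ iE] := fP _ (svalP i); have [_ jE] := fP _ (svalP j).
  rewrite -iE -jE => /(proj2 packC _ _ (svalP i) (svalP j)).
  by case: i j {ri0 rj0 meet iE jE} => [B CB] [B' CB'] /=; exact: eq_exist.
have e0 : 0 < 10 ^- 5 :> R by rewrite invr_gt0 exprn_gt0.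
have e5 : 10 ^- 5 * (10 * 10 * 10 * 10 * 10) = 1 :> R.
  by rewrite -[X in _ * X](_ : 10 ^+ 5 = _) ?mulVf ?expf_neq0//; ring.
set e := 10 ^- 5 in e0 e5 *.
have [p [u [v [u4 v4 uv SE]]]] := sqS.
(* The enlarged discs are closed, so [k] must exceed [e] strictly; [11/10 * e] still satisfies
   [k * 72800 <= 1]. *)
have [|||x [xm xC]] := @point_away_from_discs R I c r (11 / 10 * e)
  (pt p + (((pt u).1 + (pt v).1) / 2, ((pt u).2 + (pt v).2) / 2)) pk.
- by move=> i; have /andP[] := rP i.
- lra.
- lra.
have [|||||s [t [s01 t01 xE]]] := @square_contains_disc R (pt p) (pt u) (pt v) 4 x.
- by [].
- by rewrite -nrm_sqr -enorm_pt u4.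
- by rewrite -nrm_sqr -enorm_pt v4.
- by rewrite -dotv_pt.
- by apply: le_trans xm _; lra.
have {}xE : x = pt (p + s *: u + t *: v) by rewrite xE /pt !mxE.
move=> /(_ (p + s *: u + t *: v))[|E [B [c' [CB cB ->]]] [y By yx]].
  by rewrite SE; exists s, t.
have [_ BE] := fP B CB; pose i : I := exist _ B CB.
have /andP[ri0 _] := rP i.
have {cB}c'E : c' = (f B).1.
  by apply: (symmetry_center_disc ri0); rewrite -[disc _ _]BE.
(* Covering puts the point within [(1 + e) * r i] of the center, while clearance demands
   [(1 + 11/10 * e) * r i]. *)
have := xC i; rewrite /clear xE -yx c'E /c /= -ptB -enorm_pt addrK.
move: By; rewrite {1}BE /disc /closed_ball_ /= => By.
rewrite enormZ ger0_norm; last by lra.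
rewrite enorm_pt ptB -nrmN opprB -ptB -enorm_pt.
have : (1 + e) * enorm ((f B).1 - y) <= (1 + e) * r i.
  by rewrite ler_pM2l//; lra.
have : 0 < e * r i by rewrite mulr_gt0.
rewrite /r /=; lra.
Qed.
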